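(* Let $S^{\psi}_I$, $\underline S^{\psi}_I$ be the sets of vectors $\vec m\in\mathbb R^N$ realized by strong partitions and by strong subpartitions, respectively, and $S^{\psi,w}_I$, $\underline S^{\psi,w}_I$ the sets of vectors realized by weak partitions and by weak subpartitions, respectively (see context). Then $$S^{\psi}_I=S^{\psi,w}_I\qquad\text{and}\qquad \underline S^{\psi}_I=\underline S^{\psi,w}_I .$$
   Context: $X$ is a compact Polish space with Borel $\sigma$-algebra $\mathcal B$, $\mu$ is a non-atomic Borel probability measure on $X$, $I=\{1,\dots,N\}$, and $\psi_1,\dots,\psi_N:X\to\mathbb R$ are continuous. Strong (sub)partitions: for $\vec m=(m_1,\dots,m_N)\in\mathbb R^N$, $\mathcal P^{\psi}_{\vec m}$ is the set of $N$-tuples $(X_1,\dots,X_N)$ of sets in $\mathcal B$ with $\bigcup_i X_i=X$, $\mu(X_i\cap X_j)=0$ for $i\ne j$, and $\int_{X_i}\psi_i\,d\mu=m_i$ for all $i\in I$. The set $\underline{\mathcal P}^{\psi}_{\vec m}$ is defined in the same way with $\bigcup_i X_i=X$ replaced by $\bigcup_i X_i\subseteq X$. Weak (sub)partitions: $\mathcal P^{\psi,w}_{\vec m}$ is the set of $N$-tuples $\vec\mu=(\mu_1,\dots,\mu_N)$ of non-negative Borel measures on $X$ with $\sum_{i=1}^N\mu_i=\mu$ and $\int_X\psi_i\,d\mu_i=m_i$ for all $i\in I$. The set $\underline{\mathcal P}^{\psi,w}_{\vec m}$ is defined in the same way with $\sum_i\mu_i=\mu$ replaced by $\sum_i\mu_i\le\mu$.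 $S^{\psi}_I=\{\vec m\in\mathbb R^N:\mathcal P^{\psi}_{\vec m}\neq\emptyset\}$, $\underline S^{\psi}_I=\{\vec m\in\mathbb R^N:\underline{\mathcal P}^{\psi}_{\vec m}\neq\emptyset\}$, $S^{\psi,w}_I=\{\vec m\in\mathbb R^N:\mathcal P^{\psi,w}_{\vec m}\neq\emptyset\}$, $\underline S^{\psi,w}_I=\{\vec m\in\mathbb R^N:\underline{\mathcal P}^{\psi,w}_{\vec m}\neq\emptyset\}$. *)

(* Defs.v *)
From HB Require Import structures.
From mathcomp Require Import all_boot all_order all_algebra.
From mathcomp Require Import all_classical all_reals all_analysis.

Set Implicit Arguments.
Unset Strict Implicit.
Unset Printing Implicit Defensive.

Import Order.TTheory GRing.Theory Num.Theory.
Import numFieldNormedType.Exports.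

Local Open Scope classical_set_scope.
Local Open Scope ring_scope.

Definition is_metric (R : realType) (T : Type) (d : T -> T -> R) : Prop :=
  [/\ forall x y, 0 <= d x y,
      forall x y, d x y = 0 <-> x = y,
      forall x y, d x y = d y x
    & forall x y z, d x z <= d x y + d y z].

Definition metric_induces_topology (R : realType) (T : topologicalType)
    (d : T -> T -> R) : Prop :=
  forall (x : T) (A : set T),
    nbhs x A <-> exists2 e : R, 0 < e & [set y | d x y < e] `<=` A.

(* Meaningful when [d] induces the topology of [T], as in [polish_space]: the
   limit is taken in that topology. *)
Definition cauchy_complete (R : realType) (T : topologicalType)
    (d : T -> T -> R) : Prop :=
  forall u : nat -> T,
    (forall e : R, 0 < e ->
       exists n0 : nat, forall m n : nat,
         (n0 <= m)%N -> (n0 <= n)%N -> d (u m) (u n) < e) ->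
    exists l : T, u @ \oo --> l.

Definition separable_space (T : topologicalType) : Prop :=
  exists2 D : set T, countable D & dense D.

Definition polish_space (R : realType) (T : topologicalType) : Prop :=
  separable_space T /\
  exists d : T -> T -> R,
    [/\ is_metric d, metric_induces_topology d & cauchy_complete d].

(* [X] with its Borel sigma-algebra. Measurable types are pointed in the
   library, whence [ptopologicalType]; the point is not used otherwise. *)
Notation borelType X := (g_sigma_algebraType (@open X)).

Definition nonatomic (d : measure_display) (T : measurableType d)
    (R : realType) (mu : {measure set T -> \bar R}) : Prop :=
  forall A : set T, measurable A -> (0 < mu A)%E ->
    exists B : set T,
      [/\ measurable B, B `<=` A, (0 < mu B)%E & (mu B < mu A)%E].

Section partitions.
Context {R : realType} {X : ptopologicalType} {N : nat}.
Variables (mu : {measure set (borelType X) -> \bar R}) (psi : 'I_N -> X -> R).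

Definition strong_partition (m : 'rV[R]_N) : set ('I_N -> set (borelType X)) :=
  [set P | [/\ forall i, measurable (P i),
               \bigcup_i P i = setT,
               forall i j, i != j -> mu (P i `&` P j) = 0%E
             & forall i, (\int[mu]_(x in P i) (psi i x)%:E = (m ord0 i)%:E)%E]].

Definition strong_subpartition (m : 'rV[R]_N) :
    set ('I_N -> set (borelType X)) :=
  [set P | [/\ forall i, measurable (P i),
               \bigcup_i P i `<=` setT,
               forall i j, i != j -> mu (P i `&` P j) = 0%E
             & forall i, (\int[mu]_(x in P i) (psi i x)%:E = (m ord0 i)%:E)%E]].

Definition weak_partition (m : 'rV[R]_N) :
    set ('I_N -> {measure set (borelType X) -> \bar R}) :=
  [set nu | (forall A : set (borelType X), measurable A ->
               (\sum_(i < N) nu i A = mu A)%E) /\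
            (forall i, (\int[nu i]_x (psi i x)%:E = (m ord0 i)%:E)%E)].

Definition weak_subpartition (m : 'rV[R]_N) :
    set ('I_N -> {measure set (borelType X) -> \bar R}) :=
  [set nu | (forall A : set (borelType X), measurable A ->
               (\sum_(i < N) nu i A <= mu A)%E) /\
            (forall i, (\int[nu i]_x (psi i x)%:E = (m ord0 i)%:E)%E)].

Definition S_strong : set 'rV[R]_N := [set m | strong_partition m !=set0].

Definition S_strong_sub : set 'rV[R]_N :=
  [set m | strong_subpartition m !=set0].

Definition S_weak : set 'rV[R]_N := [set m | weak_partition m !=set0].

Definition S_weak_sub : set 'rV[R]_N := [set m | weak_subpartition m !=set0].

End partitions.

(* Main.v *)
Require Import Defs.
From HB Require Import structures.
From mathcomp Require Import all_boot all_order all_algebra.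
From mathcomp Require Import all_classical all_reals all_analysis.
From mathcomp Require Import measurable_realfun lra ring.

Set Implicit Arguments.
Unset Strict Implicit.
Unset Printing Implicit Defensive.

Import Order.TTheory GRing.Theory Num.Theory.
Import numFieldNormedType.Exports.

Local Open Scope classical_set_scope.
Local Open Scope ring_scope.

(** Every strong (sub)partition gives a weak one, by restricting the measure to
    its pieces. For the converse, let [g_1, ..., g_N] be the densities of the weak
    (sub)partition; what is needed is a form of the Lyapunov convexity theorem:
    disjoint sets [X_i] over which [psi_i] has the same integral as [psi_i * g_i]
    over the whole space. Compactness of the space enters only through the
    boundedness of the [psi_i].

    The theorem rests on halving: for finitely many bounded densities, every set
    [A] contains a [B] on which each of the corresponding set functions takes half
    of its value on [A] ([lyapunov_half]). For the measure alone this is the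
    theorem of Sierpinski on non-atomic measures ([sierpinski_half]). To add one
    function [nu], start from a [B] that halves all previous ones: [nu] is at most
    [nu A / 2] on one of [B] and [A \ B] and at least [nu A / 2] on the other, and
    one can interpolate between these two sets through sets that halve the
    previous functions, by exchanging halves of their differences; the Lipschitz
    dependence of [nu] on the measure gives a limit on which [nu] takes its middle
    value.

    To pass from a function [h] with values in [0, 1] to a set with the same
    integrals, replace [h] by [min (2 h) 1] on a suitable half of the space and by
    [max (2 h - 1) 0] on the other half. By halving, this can be done without
    changing the integrals of finitely many [h * f], and so that the measure of
    the set where [h] is neither 0 nor 1 is divided by two. Iterating gives in the
    limit the indicator of a set ([purification]). The construction is monotone in
    [h], so it can be applied simultaneously to the partial sums
    [g_1 + ... + g_k], which yields nested sets; the [X_i] are the differences of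
    consecutive ones ([disjoint_of_weak]). For a weak partition they cover all but
    a null set, which is added to one of them ([partition_of_weak]). *)

(** * Lipschitz additive set functions and limits of sets *)

Section SetFunctions.
Context d (T : measurableType d) (R : realType).
Variable mu : {finite_measure set T -> \bar R}.
Implicit Types (A B C D : set T) (nu : set T -> R).

Local Notation m A := (fine (mu A)).

Lemma EFin_fine_measure A : measurable A -> (m A)%:E = mu A.
Proof. by move=> mA; rewrite fineK// fin_num_measure. Qed.

Lemma fine_measure_ge0 A : 0 <= m A.
Proof. by rewrite fine_ge0. Qed.

Lemma fine_measure_le A B : measurable A -> measurable B -> A `<=` B -> m A <= m B.
Proof.
move=> mA mB AB; rewrite -lee_fin !EFin_fine_measure//.
by apply: le_measure => //; rewrite inE.
Qed.

(** The Lipschitz clause makes [nu] pass to limits of sets in measure, so that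
    finite additivity suffices; integration of a bounded function is the
    example that matters. *)
Definition lip_additive nu :=
  (forall A B, measurable A -> measurable B -> A `&` B = set0 ->
     nu (A `|` B) = nu A + nu B) /\
  exists2 C : R, 0 <= C & forall A, measurable A -> `|nu A| <= C * m A.

Lemma lip_additive_measure : lip_additive (fun A => m A).
Proof.
split=> [A B mA mB AB0|].
  by rewrite measureU// fineD// fin_num_measure.
by exists 1 => // A mA; rewrite mul1r ger0_norm ?fine_measure_ge0.
Qed.

Section AdditiveSetFunction.
Variables (nu : set T -> R) (nu_lip : lip_additive nu).

Lemma lip_additiveU A B : measurable A -> measurable B -> A `&` B = set0 ->
  nu (A `|` B) = nu A + nu B.
Proof. by case: nu_lip => + _; exact. Qed.

Lemma lip_additive_split A B : measurable A -> measurable B ->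
  nu A = nu (A `&` B) + nu (A `\` B).
Proof.
move=> mA mB; rewrite -lip_additiveU ?setUIDK//.
- exact: measurableI.
- exact: measurableD.
- by rewrite setDE setIACA setICr setI0.
Qed.

Lemma lip_additiveD A B : measurable A -> measurable B -> B `<=` A ->
  nu (A `\` B) = nu A - nu B.
Proof.
move=> mA mB BA; rewrite (lip_additive_split mA mB) (setIidr BA).
by rewrite addrAC subrr add0r.
Qed.

End AdditiveSetFunction.

Definition sdist A B : R := m (A `\` B) + m (B `\` A).

Lemma lip_additive_sdist nu : lip_additive nu -> exists2 C : R, 0 <= C &
  forall A B, measurable A -> measurable B -> `|nu A - nu B| <= C * sdist A B.
Proof.
move=> nul; have [_ [C C0 nuC]] := nul; exists C => // A B mA mB.
rewrite (lip_additive_split nul mA mB) (lip_additive_split nul mB mA) setIC.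
rewrite opprD addrACA subrr add0r mulrDr.
apply: (le_trans (ler_normB _ _)).
by apply: lerD; apply: nuC; exact: measurableD.
Qed.

Lemma fine_measure_bigcup_le (E : nat -> set T) A (e : R) : measurable A ->
  (forall k, measurable (E k)) -> A `<=` \bigcup_k E k -> 0 <= e ->
  (forall k, m (E k) <= e / 2 ^+ k.+1) -> m A <= e.
Proof.
move=> mA mE AE e0 Ee; rewrite -lee_fin EFin_fine_measure//.
apply: le_trans.
  exact: (@measure_sigma_subadditive _ _ _ mu A E).
apply: (le_trans _ (epsilon_trick0 xpredT e0)).
apply: lee_nneseries => // k _.
by rewrite /= -(EFin_fine_measure (mE k)) lee_fin natrX; exact: Ee.
Qed.

(** Sets whose successive distances decay geometrically converge to their lower
    limit: a point in which [D n] and the limit differ must change sides between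
    some later [D (n + k)] and [D (n + k).+1], and these changes have summable
    measure. *)
Lemma sdist_liminf (D : nat -> set T) (c : R) : 0 <= c ->
  (forall n, measurable (D n)) ->
  (forall n, sdist (D n) (D n.+1) <= c / 2 ^+ n) ->
  let L := \bigcup_n \bigcap_k D (n + k)%N in
  measurable L /\ forall n, sdist (D n) L <= 4 * c / 2 ^+ n.
Proof.
move=> c0 mD Dc L.
have mL : measurable L.
  by apply: bigcup_measurable => n _; apply: bigcap_measurable => // k _.
split=> // n.
have e0 : 0 <= 2 * c / 2 ^+ n by rewrite divr_ge0// ?mulr_ge0// exprn_ge0.
have ek k : 2 * c / 2 ^+ n / 2 ^+ k.+1 = c / 2 ^+ (n + k).
  by rewrite exprS exprD; field; rewrite !expf_neq0.
rewrite (_ : 4 * c / 2 ^+ n = 2 * c / 2 ^+ n + 2 * c / 2 ^+ n); last first.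
  by field; rewrite !expf_neq0.
apply: lerD.
- apply: (@fine_measure_bigcup_le (fun k => D (n + k)%N `\` D (n + k).+1)) => //.
  + exact: measurableD.
  + by move=> k; exact: measurableD.
  + move=> x [Dnx nLx]; apply: contrapT => /= nE; apply: nLx.
    exists n => // k _; elim: k => [|k IH]; first by rewrite /= addn0.
    by apply: contrapT => nD; apply: nE; exists k => //; rewrite -addnS.
  + by move=> k; rewrite ek; apply: (le_trans _ (Dc _));
      rewrite lerDl fine_measure_ge0.
- apply: (@fine_measure_bigcup_le (fun k => D (n + k).+1 `\` D (n + k)%N)) => //.
  + exact: measurableD.
  + by move=> k; exact: measurableD.
  + move=> x [[n' _ Lx] nDx]; apply: contrapT => /= nE.
    have nD k : ~ D (n + k)%N x.
      elim: k => [|k IH]; first by rewrite addn0.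
      by move=> Dx; apply: nE; exists k => //; rewrite -addnS.
    by apply: (nD n'); rewrite addnC; exact: (Lx n).
  + by move=> k; rewrite ek; apply: (le_trans _ (Dc _));
      rewrite lerDr fine_measure_ge0.
Qed.

Lemma le_geometric_eq0 (x c : R) : (forall n, `|x| <= c / 2 ^+ n) -> x = 0.
Proof.
move=> xc; apply/eqP; rewrite -normr_le0; apply/ler_addgt0Pr => e e0.
rewrite add0r.
have c0 : 0 <= c by have := xc 0%N; rewrite expr0 divr1; exact: le_trans.
have [N cN] : exists N : nat, c / e < 2 ^+ N.
  exists (Num.truncn (c / e)).+1; have := truncnS_gt (c / e) => /lt_le_trans; apply.
  by rewrite -natrX ler_nat; apply/ltnW/ltn_expl.
apply: (le_trans (xc N)); rewrite ler_pdivrMr ?exprn_gt0// mulrC.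
by rewrite -ler_pdivrMr// ltW.
Qed.

End SetFunctions.

(** * The theorem of Sierpinski *)

Section Sierpinski.
Context d (T : measurableType d) (R : realType).
Variable mu : {finite_measure set T -> \bar R}.
Implicit Types A B C D : set T.

Local Notation m A := (fine (mu A)).

Lemma nonatomic_split A : nonatomic mu -> measurable A -> 0 < m A ->
  exists B, [/\ measurable B, B `<=` A, 0 < m B & m B <= m A / 2].
Proof.
move=> mu_nonatomic mA A0.
have muA0 : (0 < mu A)%E by rewrite -(EFin_fine_measure mu).
have [B [mB BA B0 BltA]] : exists B, [/\ measurable B, B `<=` A, (0 < mu B)%E &
    (mu B < mu A)%E] := mu_nonatomic A mA muA0.
move: B0 BltA; rewrite -(EFin_fine_measure mu mA) -(EFin_fine_measure mu mB).
rewrite !lte_fin => B0 BltA.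
have [BA2|BA2] := leP (m B) (m A / 2); first by exists B.
exists (A `\` B); split; [exact: measurableD|exact: subDsetl| |];
  by rewrite (lip_additiveD (lip_additive_measure mu))//; lra.
Qed.

Lemma nonatomic_small A (e : R) : nonatomic mu ->
  measurable A -> 0 < m A -> 0 < e ->
  exists B, [/\ measurable B, B `<=` A, 0 < m B & m B <= e].
Proof.
move=> mu_nonatomic mA A0 e0.
have halve n : exists B, [/\ measurable B, B `<=` A, 0 < m B &
    m B <= m A / 2 ^+ n].
  elim: n => [|n [B [mB BA B0 Bn]]].
    by exists A; split=> //; rewrite expr0 divr1.
  have [B' [mB' B'B B'0 B'le]] := nonatomic_split mu_nonatomic mB B0.
  exists B'; split => //; first exact: subset_trans BA.
  by rewrite exprSr invfM mulrA; apply: (le_trans B'le); rewrite ler_pM2r.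
apply: contrapT => noB; suff A00 : m A = 0 by rewrite A00 ltxx in A0.
apply: (@le_geometric_eq0 _ _ (m A * m A / e)) => n.
have [B [mB BA B0 Bn]] := halve n.
have eB : e < m B by rewrite ltNge; apply/negP => Be; apply: noB; exists B.
have e1 : 1 <= m A / e / 2 ^+ n.
  by rewrite mulrAC ler_pdivlMr// mul1r; exact: ltW (lt_le_trans eB Bn).
rewrite ger0_norm ?fine_measure_ge0//.
rewrite (_ : _ / 2 ^+ n = m A * (m A / e / 2 ^+ n)); last by rewrite !mulrA.
by rewrite ler_peMr// fine_measure_ge0.
Qed.

(** Greedy exhaustion: starting from the empty set, add at each step a piece of
    [A] whose measure is at least half of the largest one that keeps the total
    at most [m A / 2]. If the union fell short of [m A / 2], a small piece of
    what remains would have been a candidate at every step, so that infinitely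
    many disjoint pieces at least half as large would have been added. *)
Theorem sierpinski_half A : nonatomic mu -> measurable A ->
  exists B, [/\ measurable B, B `<=` A & m B = m A / 2].
Proof.
move=> mu_nonatomic mA; set t := m A / 2.
have tA : 0 <= t by rewrite divr_ge0// fine_measure_ge0.
pose adm B C := [/\ measurable C, C `<=` A `\` B & m B + m C <= t].
(* the totalised form of the greedy step, for which a choice function exists *)
have admP B : exists C, measurable B -> m B <= t ->
    adm B C /\ forall C', adm B C' -> m C' <= 2 * m C.
  have [[mB Bt]|nB] := pselect (measurable B /\ m B <= t); last first.
    by exists set0 => mB Bt; exfalso; apply: nB.
  pose S := [set m C | C in adm B].
  have adm0 : adm B set0.
    split; [exact: measurable0|exact: sub0set|].
    by rewrite measure0 addr0.
  have supS : has_sup S.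
    split; first by exists (m (set0 : set T)); exists set0.
    exists t => _ [C [mC _ Ct] <-]; apply: (le_trans _ Ct).
    by rewrite lerDr fine_measure_ge0.
  have supge C : adm B C -> m C <= sup S.
    by move=> BC; apply: ub_le_sup; [case: supS|exists C].
  have [S0|S0] := leP (sup S) 0.
    exists set0 => _ _; split=> // C' /supge /le_trans -> //.
    by rewrite measure0 mulr0.
  have [|_ [C BC <-] Clt] := @sup_adherent _ S (sup S / 2) _ supS.
    by rewrite divr_gt0.
  exists C => _ _; split=> // C' /supge /le_trans -> //.
  by move: Clt; lra.
have [f fP] := choice admP.
pose D n := iter n (fun B => B `|` f B) set0.
have DP n : [/\ measurable (D n), D n `<=` A & m (D n) <= t].
  elim: n => [|n [mD DA Dt]].
    by split; [exact: measurable0|exact: sub0set|rewrite /= measure0].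
  have [[mf fA ft] _] := fP _ mD Dt.
  split; first exact: measurableU.
    by rewrite subUset; split => // x /fA[].
  rewrite /= (lip_additiveU (lip_additive_measure mu))//.
  by apply/seteqP; split => // x [Dx /fA[]].
have fDP n : adm (D n) (f (D n)) /\
    forall C', adm (D n) C' -> m C' <= 2 * m (f (D n)).
  by have [? _ ?] := DP n; exact: fP.
have mDS n : m (D n.+1) = m (D n) + m (f (D n)).
  have [mD _ _] := DP n; have [[mf fA _] _] := fDP n.
  rewrite /= (lip_additiveU (lip_additive_measure mu))//.
  by apply/seteqP; split => // x [Dx /fA[]].
pose L := \bigcup_n D n.
have mD n : measurable (D n) by case: (DP n).
have mL : measurable L by exact: bigcup_measurable.
have LA : L `<=` A by move=> x [n _]; case: (DP n) => _ + _; exact.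
have Lt : m L <= t.
  have ndD : nondecreasing_seq D.
    by apply/nondecreasing_seqP => n; apply/subsetPset => x Dx; left.
  rewrite -lee_fin (EFin_fine_measure mu)//.
  have := nondecreasing_cvg_mu (mu := mu) mD mL ndD.
  move/cvg_lim => <- //; apply: lime_le.
    apply: ereal_nondecreasing_is_cvgn => n k nk.
    by apply: le_measure; rewrite ?inE//; exact/subsetPset/ndD.
  apply: nearW => n /=; rewrite -(EFin_fine_measure mu)// lee_fin; by case: (DP n).
exists L; split=> //; apply/eqP; rewrite eq_le Lt /= leNgt; apply/negP => Llt.
have mAL : m (A `\` L) = m A - m L.
  by rewrite (lip_additiveD (lip_additive_measure mu)).
have mAL0 : 0 < m (A `\` L) by rewrite mAL; move: Llt tA; rewrite /t; lra.
have tL0 : 0 < t - m L by rewrite subr_gt0.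
have [C [mC CAL C0 Ct]] := 
  nonatomic_small mu_nonatomic (measurableD mA mL) mAL0 tL0.
have Cf n : m C <= 2 * m (f (D n)).
  have [_] := fDP n; apply; split=> //.
    by apply: (subset_trans CAL); apply: setDS => x Dx; exists n.
  have : m (D n) <= m L by apply: fine_measure_le => // x Dx; exists n.
  by move: Ct; lra.
have Dge n : n%:R * (m C / 2) <= m (D n).
  elim: n => [|n IH]; first by rewrite mul0r fine_measure_ge0.
  by rewrite mDS -natr1 mulrDl mul1r; have := Cf n; move: IH; lra.
have := Dge (Num.truncn (t / (m C / 2))).+1; rewrite leNgt => /negP; apply.
have [_ _ /le_lt_trans] := DP (Num.truncn (t / (m C / 2))).+1; apply.
by rewrite -ltr_pdivrMr ?divr_gt0//; exact: truncnS_gt.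
Qed.

End Sierpinski.

(** * Halving finitely many set functions *)

Section Halving.
Context d (T : measurableType d) (R : realType).
Variable mu : {finite_measure set T -> \bar R}.
Implicit Types (A B C D : set T) (F : nat -> set T -> R).

Local Notation m A := (fine (mu A)).
Local Notation sdist := (sdist mu).

Definition halves F n A B :=
  [/\ measurable B, B `<=` A & forall i, (i < n)%N -> F i B = F i A / 2].

Definition halvable F n := forall A, measurable A -> exists B, halves F n A B.

Lemma halves_setD F n A B : (forall i, lip_additive mu (F i)) ->
  measurable A -> halves F n A B -> halves F n A (A `\` B).
Proof.
move=> Fl mA [mB BA FB]; split; [exact: measurableD|exact: subDsetl|].
by move=> i lin; rewrite (lip_additiveD (Fl i))// FB//; lra.
Qed.

(** If [B] and [C] both halve [A], then each of the [n] functions takes equal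
    values on [B \ C] and [C \ B], so that half of one may be exchanged for half
    of the other: the result still halves [A] and lies midway between [B] and [C]. *)
Lemma halves_mid F n A B C : (forall i, lip_additive mu (F i)) ->
  F 0%N = (fun D => m D) -> (0 < n)%N -> halvable F n -> measurable A ->
  halves F n A B -> halves F n A C ->
  exists D, [/\ halves F n A D, sdist B D = sdist B C / 2 &
    sdist D C = sdist B C / 2].
Proof.
move=> Fl F0 n0 Fn mA [mB BA FB] [mC CA FC].
have mBC := measurableD mB mC; have mCB := measurableD mC mB.
have [S [mS SBC FS]] := Fn _ mBC; have [U [mU UCB FU]] := Fn _ mCB.
have mmS : m S = m (B `\` C) / 2 by have := FS _ n0; rewrite F0.
have mmU : m U = m (C `\` B) / 2 by have := FU _ n0; rewrite F0.
have SB : S `<=` B by move=> x /SBC[].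
have UB : (B `\` S) `&` U = set0 by apply/seteqP; split => // x [[Bx _] /UCB[]].
have mBS := measurableD mB mS.
have ml := lip_additive_measure mu.
pose D := (B `\` S) `|` U.
exists D; split.
- split; first exact: measurableU.
    by rewrite subUset; split=> x; [move=> [/BA]|move=> /UCB[/CA]].
  move=> i lin; rewrite (lip_additiveU (Fl i))// (lip_additiveD (Fl i))//.
  have := lip_additive_split (Fl i) mB mC.
  have := lip_additive_split (Fl i) mC mB.
  by rewrite setIC FS// FU// FB// FC//; lra.
- rewrite /sdist (_ : B `\` D = S); last first.
    apply/seteqP; split=> [x [Bx nx]|x Sx].
      by apply: contrapT => nSx; apply: nx; left.
    by split; [exact: SB|move=> [[]//|/UCB[_]]; apply; exact: SB].
  rewrite (_ : D `\` B = U); last first.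
    apply/seteqP; split=> [x [[[]//|//]]|x Ux].
    by split; [right|case: (UCB _ Ux)].
  by rewrite mmS mmU; lra.
- rewrite /sdist (_ : D `\` C = (B `\` C) `\` S); last first.
    apply/seteqP; split=> [x [[[Bx nSx]|/UCB[]//] nCx]//|x [[Bx nCx] nSx]].
    by split=> //; left.
  rewrite (_ : C `\` D = (C `\` B) `\` U); last first.
    apply/seteqP; split=> [x [Cx nx]|x [[Cx nBx] nUx]].
      split; last by move=> Ux; apply: nx; right.
      split=> // Bx; apply: nx; left; split=> //.
      by move=> /SBC[].
    by split=> // -[[]|].
  have := lip_additiveD ml mBC mS SBC; have := lip_additiveD ml mCB mU UCB.
  by rewrite /= mmS mmU => -> ->; lra.
Qed.

(** A discrete intermediate value argument. A set [B] that halves [A] for the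
    first [n] functions and its complement in [A] have [F n] on opposite sides
    of [F n A / 2]; bisecting with [halves_mid], always keeping two sets on
    opposite sides, produces two sequences that merge in measure, and their
    common limit halves [A] for [F n] too. The measure is required as [F 0]
    because the merging is expressed through it. *)
Lemma halvableS F n : (forall i, lip_additive mu (F i)) ->
  F 0%N = (fun D => m D) -> (0 < n)%N -> halvable F n -> halvable F n.+1.
Proof.
move=> Fl F0 n0 Fn A mA; set t := F n A / 2.
pose inv (p : set T * set T) :=
  [/\ halves F n A p.1, halves F n A p.2 & F n p.1 <= t <= F n p.2].
have [p0 p0P] : exists p0, inv p0.
  have [B hB] := Fn _ mA; have hAB := halves_setD Fl mA hB.
  have [mB BA _] := hB.
  have FAB : F n (A `\` B) = F n A - F n B by rewrite (lip_additiveD (Fl n)).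
  have [Bt|tB] := leP (F n B) t.
    exists (B, A `\` B); split=> //=; rewrite Bt /= FAB.
    by move: Bt; rewrite /t; lra.
  exists (A `\` B, B); split=> //=; rewrite (ltW tB) andbT FAB.
  by move: tB; rewrite /t; lra.
have step p : exists q, inv p -> [/\ inv q,
    sdist q.1 q.2 = sdist p.1 p.2 / 2 & sdist p.1 q.1 <= sdist p.1 p.2].
  have [[h1 h2 /andP[p1t tp2]]|np] := pselect (inv p); last by exists p => /np.
  have [D [hD D1 D2]] := halves_mid Fl F0 n0 Fn mA h1 h2.
  have sd0 : 0 <= sdist p.1 p.2 by rewrite addr_ge0// fine_measure_ge0.
  have [Dt|tD] := leP (F n D) t.
    by exists (D, p.2) => _; split=> //=; [split=> //=; rewrite Dt|rewrite D1; lra].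
  exists (p.1, D) => _; split=> //=; first by split=> //=; rewrite p1t ltW.
  by rewrite /sdist setDv measure0 addr0.
have [f fP] := choice step.
pose p k := iter k f p0.
have pinv k : inv (p k) by elim: k => [//|k IH]; case: (fP _ IH).
pose c := sdist p0.1 p0.2.
have c0 : 0 <= c by rewrite addr_ge0// fine_measure_ge0.
have pc k : sdist (p k).1 (p k).2 = c / 2 ^+ k.
  elim: k => [|k IH]; first by rewrite expr0 divr1.
  by have [_ /= -> _] := fP _ (pinv k); rewrite IH exprSr invfM mulrA.
pose D k := (p k).1.
have hD k : halves F n A (D k) by case: (pinv k).
have mD k : measurable (D k) by case: (hD k).
have Dc k : sdist (D k) (D k.+1) <= c / 2 ^+ k.
  by have [_ _] := fP _ (pinv k); rewrite pc.
have [] := sdist_liminf c0 mD Dc; set L := \bigcup_k _ => mL DL.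
have FL i (x : R) (C' : R) :
    (forall k, `|F i (D k) - x| <= C' / 2 ^+ k) -> F i L = x.
  move=> Dx; have [C C0 FC] := lip_additive_sdist (Fl i).
  apply/eqP; rewrite -subr_eq0; apply/eqP.
  apply: (@le_geometric_eq0 _ _ (C * (4 * c) + C')) => k.
  rewrite mulrDl.
  rewrite (_ : F i L - x = (F i L - F i (D k)) + (F i (D k) - x));
    last by rewrite addrA subrK.
  apply: (le_trans (ler_normD _ _)); apply: lerD => //.
  rewrite distrC; apply: (le_trans (FC _ _ (mD k) mL)).
  by rewrite -[C * (4 * c) / _]mulrA; apply: ler_wpM2l => //; exact: DL.
exists L; split=> //.
  move=> x [k _ /(_ 0%N I)]; rewrite addn0.
  by have [_ + _] := hD k; exact.
move=> i; rewrite ltnS leq_eqVlt => /predU1P[->|lin].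
  have [C C0 FC] := lip_additive_sdist (Fl n).
  apply: (FL _ _ (C * c)) => k.
  have [_ [mE _ _] /andP[Dt tE]] := pinv k.
  apply: (@le_trans _ _ `|F n (p k).1 - F n (p k).2|); last first.
    by rewrite -mulrA -pc; exact: FC (mD k) mE.
  rewrite !ler0_norm; [|lra|by move: Dt; rewrite /t; lra].
  by move: tE; rewrite /D /t; lra.
apply: (FL _ _ 0) => k; have [_ _ ->//] := hD k.
by rewrite subrr normr0 mul0r.
Qed.

(** The midpoint case of the Lyapunov convexity theorem. *)
Theorem lyapunov_half (J : finType) (F : J -> set T -> R) A :
  nonatomic mu -> (forall j, lip_additive mu (F j)) -> measurable A ->
  exists B, [/\ measurable B, B `<=` A & forall j, F j B = F j A / 2].
Proof.
move=> mu_na Fl mA.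
(* the measure is listed first, as [halvableS] requires, and fills the
   positions past the end of the enumeration *)
pose G k : set T -> R :=
  if k is k'.+1 then
    if insub k' is Some o then F (enum_val (o : 'I_#|J|)) else fun D => m D
  else fun D => m D.
have Gl k : lip_additive mu (G k).
  case: k => [|k]; first exact: lip_additive_measure.
  by rewrite /G; case: insubP => [i _ _|_]; [exact: Fl|exact: lip_additive_measure].
have hG n : halvable G n.+1.
  elim: n => [|n IH]; last exact: halvableS.
  move=> B mB; have [C [mC CB mmC]] := sierpinski_half mu_na mB.
  by exists C; split=> //; case.
have [B [mB BA GB]] := hG #|J| _ mA; exists B; split=> // j.
have := GB (enum_rank j).+1 (ltn_ord (enum_rank j)).
rewrite /G; case: insubP => [i _ ij|]; last by rewrite ltn_ord.
by rewrite (_ : i = enum_rank j) ?enum_rankK//; exact: val_inj.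
Qed.

End Halving.

(** * Bounded measurable functions *)

Section Integrals.
Context d (T : measurableType d) (R : realType).
Variable mu : {finite_measure set T -> \bar R}.
Implicit Types (A B : set T) (f g h : T -> R).

Local Notation m A := (fine (mu A)).

Definition bounded_measurable f :=
  measurable_fun [set: T] f /\ exists C : R, forall x, `|f x| <= C.

Lemma bmeas_cst (c : R) : bounded_measurable (fun=> c).
Proof. by split; [exact: measurable_cst|exists `|c|]. Qed.

Lemma bmeas_indic A : measurable A -> bounded_measurable (\1_A : T -> R).
Proof.
move=> mA; split; first exact: measurable_indic.
by exists 1 => x; rewrite indicE; case: (x \in A); rewrite ?normr1 ?normr0.
Qed.

Lemma bmeasD f g : bounded_measurable f -> bounded_measurable g ->
  bounded_measurable (fun x => f x + g x).
Proof.
move=> [mf [Cf fC]] [mg [Cg gC]]; split; first exact: measurable_funD.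
by exists (Cf + Cg) => x; apply: (le_trans (ler_normD _ _)); exact: lerD.
Qed.

Lemma bmeasM f g : bounded_measurable f -> bounded_measurable g ->
  bounded_measurable (fun x => f x * g x).
Proof.
move=> [mf [Cf fC]] [mg [Cg gC]]; split; first exact: measurable_funM.
by exists (Cf * Cg) => x; rewrite normrM; apply: ler_pM.
Qed.

Lemma bmeasN f : bounded_measurable f -> bounded_measurable (fun x => - f x).
Proof.
move=> [mf [C fC]]; split; first exact: measurable_funN.
by exists C => x; rewrite normrN.
Qed.

Lemma bmeasB f g : bounded_measurable f -> bounded_measurable g ->
  bounded_measurable (fun x => f x - g x).
Proof. by move=> hf hg; apply: bmeasD => //; exact: bmeasN. Qed.

Lemma bmeas_integrable A f : measurable A -> bounded_measurable f ->
  mu.-integrable A (EFin \o f).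
Proof.
move=> mA [mf [C fC]]; apply: measurable_bounded_integrable => //.
- by rewrite -ge0_fin_numE// fin_num_measure.
- exact: measurable_funTS.
- exists C; split; first exact: num_real.
  by move=> M CM x _; apply: (le_trans (fC x)); exact: ltW.
Qed.

Lemma Rintegral_indic A f :
  \int[mu]_(x in A) f x = \int[mu]_x (f x * \1_A x).
Proof.
rewrite Rintegral_mkcond; apply: eq_Rintegral => x _.
by rewrite patchE indicE; case: (x \in A); rewrite ?mulr1 ?mulr0.
Qed.

Lemma bmeas_le_Rintegral A f (C : R) : measurable A -> bounded_measurable f ->
  (forall x, `|f x| <= C) -> `|\int[mu]_(x in A) f x| <= C * m A.
Proof.
move=> mA hf fC; rewrite -Rintegral_cst//.
have fint := bmeas_integrable mA hf.
apply: (le_trans (le_normr_Rintegral mA fint)).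
apply: le_Rintegral => //.
- have [mf _] := hf; apply: (bmeas_integrable mA); split.
    exact: measurableT_comp.
  by exists C => x; rewrite normr_id.
- exact: (bmeas_integrable mA (bmeas_cst C)).
Qed.

Lemma lip_additive_Rintegral f : bounded_measurable f ->
  lip_additive mu (fun A => \int[mu]_(x in A) f x).
Proof.
move=> hf; split=> [A B mA mB AB0|].
  rewrite Rintegral_setU//; last by apply/disj_set2P.
  by apply: bmeas_integrable => //; exact: measurableU.
have [_ [C fC]] := hf; exists `|C| => // A mA.
apply: bmeas_le_Rintegral => // x; exact: le_trans (fC x) (ler_norm _).
Qed.

Lemma lip_additive_measureI A : measurable A ->
  lip_additive mu (fun B => m (A `&` B)).
Proof.
move=> mA; split=> [B C mB mC BC0|].
  rewrite setIUr (lip_additiveU (lip_additive_measure mu))//;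
    try exact: measurableI.
  by rewrite setIACA BC0 setI0.
exists 1 => // B mB; rewrite mul1r ger0_norm ?fine_measure_ge0//.
by apply: fine_measure_le => //; exact: measurableI.
Qed.

End Integrals.

(** * The doubling map on fuzzy sets *)

Section Doubling.
Context d (T : measurableType d) (R : realType).
Variable mu : {finite_measure set T -> \bar R}.
Implicit Types (A B : set T) (f g h : T -> R).

Local Notation m A := (fine (mu A)).

Definition fuzzy_set h :=
  measurable_fun [set: T] h /\ forall x, 0 <= h x <= 1.

Lemma fuzzy_bmeas h : fuzzy_set h -> bounded_measurable h.
Proof.
move=> [mh h01]; split=> //; exists 1 => x.
by have /andP[h0 h1] := h01 x; rewrite ger0_norm.
Qed.

(** The distance from [h x] to [{0, 1}]. *)
Definition margin h x := Num.min (h x) (1 - h x).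

Lemma fuzzy_margin h : fuzzy_set h -> fuzzy_set (margin h).
Proof.
move=> [mh h01]; split.
  by apply: measurable_minr => //; apply: measurable_funB.
by move=> x; rewrite /margin; have := h01 x; case: (ltP (h x) (1 - h x)); lra.
Qed.

(** Doubling map on the values of [h]: [min (2 h) 1] on [B] and
    [max (2 h - 1) 0] off [B], the two outcomes of reading the next binary digit
    of a threshold. Written as [h] plus or minus its margin, it visibly keeps
    the integral of [h] against [f] when [B] halves the integral of
    [margin h * f]. *)
Definition doubling B h x := h x + margin h x * (2 * \1_B x - 1).

Lemma doubling_in B h x : B x -> doubling B h x = Num.min (2 * h x) 1.
Proof.
by move=> Bx; rewrite /doubling /margin indicE mem_set// mulr1n mulr1;
  case: (ltP (h x) (1 - h x)); case: (ltP (2 * h x) 1); lra.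
Qed.

Lemma doubling_out B h x : ~ B x -> doubling B h x = Num.max (2 * h x - 1) 0.
Proof.
by move=> Bx; rewrite /doubling /margin indicE memNset// mulr0n mulr0;
  case: (ltP (h x) (1 - h x)); case: (ltP (2 * h x - 1) 0); lra.
Qed.

Lemma doubling_fuzzy B h : measurable B -> fuzzy_set h -> fuzzy_set (doubling B h).
Proof.
move=> mB fh; split.
  have [mc _] := fuzzy_margin fh; have [mh _] := fh.
  apply: measurable_funD => //; apply: measurable_funM => //.
  by apply: measurable_funB => //; apply: measurable_funM => //;
    exact: measurable_indic.
move=> x; have [_ /(_ x) h01] := fh.
have [Bx|Bx] := pselect (B x).
  by rewrite doubling_in//; case: (ltP (2 * h x) 1); lra.
by rewrite doubling_out//; case: (ltP (2 * h x - 1) 0); lra.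
Qed.

Lemma le_doubling B h k x : h x <= k x -> doubling B h x <= doubling B k x.
Proof.
move=> hk; have [Bx|Bx] := pselect (B x).
  by rewrite !doubling_in//; case: (ltP (2 * h x) 1); case: (ltP (2 * k x) 1); lra.
rewrite !doubling_out//; case: (ltP (2 * h x - 1) 0);
  by case: (ltP (2 * k x - 1) 0); lra.
Qed.

Lemma doubling_crisp B h x : h x = 0 \/ h x = 1 -> doubling B h x = h x.
Proof.
by move=> h01; rewrite /doubling /margin; case: (ltP (h x) (1 - h x));
  case: h01 => ->; lra.
Qed.

Definition undecided h := [set x | 0 < h x < 1].

(** Doubling decides the points of [low h] that lie off [B], with value 0, and
    the points of [high h] that lie in [B], with value 1. *)
Definition low h := [set x | 0 < h x <= 1 / 2].
Definition high h := [set x | 1 / 2 < h x < 1].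

Lemma measurable_between h (a b : R) : measurable_fun [set: T] h ->
  measurable [set x | a < h x < b].
Proof.
move=> mh; rewrite (_ : [set x | _] = setT `&` h @^-1` `]a, b[%classic).
  exact: mh.
by rewrite setTI; apply/seteqP; split=> x /=; rewrite in_itv.
Qed.

Lemma measurable_low h : measurable_fun [set: T] h -> measurable (low h).
Proof.
move=> mh; rewrite (_ : low h = setT `&` h @^-1` `]0, (1 / 2)]%classic).
  exact: mh.
by rewrite setTI; apply/seteqP; split=> x /=; rewrite in_itv.
Qed.

Lemma undecidedE h : undecided h = low h `|` high h.
Proof.
apply/seteqP; split=> x /=; rewrite /undecided /low /high /=; last first.
  by case; lra.
by have [] := leP (h x) (1 / 2); [left|right]; lra.
Qed.

(** One set [B] serves all the [h i] at once: it halves, besides the integrals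
    of [margin (h i) * f j], the measures of [low (h i)] and [high (h i)],
    and the still undecided points are in [low (h i)] within [B] or in
    [high (h i)] off [B]. *)
Lemma doubling_step (I J : finType) (h : I -> T -> R) (f : J -> T -> R) :
  nonatomic mu -> (forall i, fuzzy_set (h i)) ->
  (forall j, bounded_measurable (f j)) ->
  exists B, [/\ measurable B,
    forall i j, \int[mu]_x (doubling B (h i) x * f j x) =
                \int[mu]_x (h i x * f j x) &
    forall i, m (undecided (doubling B (h i))) <= m (undecided (h i)) / 2].
Proof.
move=> mu_na fh hf.
pose F (k : I * J + I * bool) A : R :=
  match k with
  | inl (i, j) => \int[mu]_(x in A) (margin (h i) x * f j x)
  | inr (i, b) => m ((if b then low (h i) else high (h i)) `&` A)
  end.
have mlow i : measurable (low (h i)) by apply: measurable_low; case: (fh i).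
have mhigh i : measurable (high (h i)) by apply: measurable_between; case: (fh i).
have hcf i j : bounded_measurable (fun x => margin (h i) x * f j x).
  by apply: bmeasM => //; exact/fuzzy_bmeas/fuzzy_margin.
have Fl k : lip_additive mu (F k).
  case: k => [[i j]|[i b]]; first exact: lip_additive_Rintegral.
  by apply: lip_additive_measureI; case: b.
have [B [mB _ FB]] := lyapunov_half mu_na Fl measurableT.
exists B; split=> // [i j|i].
- transitivity (\int[mu]_x (h i x * f j x + (margin (h i) x * f j x * \1_B x * 2
      - margin (h i) x * f j x))).
    by apply: eq_Rintegral => x _; rewrite /doubling; ring.
  have hhf : bounded_measurable (fun x => h i x * f j x).
    by apply: bmeasM => //; exact: fuzzy_bmeas.
  have hcfB : bounded_measurable (fun x => margin (h i) x * f j x * \1_B x).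
    by apply: bmeasM => //; exact: bmeas_indic.
  have hcfB2 := bmeasM hcfB (bmeas_cst T (2 : R)).
  have hcc := bmeasB hcfB2 (hcf i j).
  rewrite RintegralD//; try exact: bmeas_integrable.
  rewrite RintegralB//; try exact: bmeas_integrable.
  rewrite RintegralZr//; try exact: bmeas_integrable.
  rewrite -(Rintegral_indic mu B (fun x => margin (h i) x * f j x)).
  by have := FB (inl (i, j)); rewrite /F => ->; lra.
- have ml := lip_additive_measure mu.
  have mundec g : fuzzy_set g -> measurable (undecided g).
    by case=> mg _; apply: measurable_between.
  have := FB (inr (i, true)); have := FB (inr (i, false)); rewrite /F !setIT.
  have lh0 : low (h i) `&` high (h i) = set0.
    by apply/seteqP; split => // x; rewrite /low /high /=; lra.
  rewrite (undecidedE (h i)) (lip_additiveU ml)// => highB lowB.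
  have mhB : measurable (high (h i) `\` B) by exact: measurableD.
  have mlB : measurable (low (h i) `&` B) by exact: measurableI.
  apply: (@le_trans _ _ (m ((low (h i) `&` B) `|` (high (h i) `\` B)))).
    apply: fine_measure_le; first exact/mundec/doubling_fuzzy.
      exact: measurableU.
    move=> x; rewrite /undecided /low /high /= => xU.
    have [Bx|Bx] := pselect (B x).
      left; split=> //; move: xU; rewrite doubling_in//.
      by case: (ltP (2 * h i x) 1); lra.
    right; split=> //; move: xU; rewrite doubling_out//.
    by case: (ltP (2 * h i x - 1) 0); lra.
  rewrite (lip_additiveU ml)//; last first.
    by apply/seteqP; split => // x [[_ Bx] [_]].
  by have := lip_additive_split ml (mhigh i) mB; lra.
Qed.

End Doubling.

(** * From fuzzy sets to sets *)

Section Purification.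
Context d (T : measurableType d) (R : realType).
Variable mu : {finite_measure set T -> \bar R}.
Implicit Types (A B : set T).

Local Notation m A := (fine (mu A)).

(** Iterated doubling turns fuzzy sets into sets. The undecided part of each
    [h i] is halved at every step while decided points keep their value 0 or 1,
    so the points that are eventually given the value 1 form a set whose
    indicator differs from the n-th iterate only on a set of measure
    [O(2^-n)]; the integrals against the [f j] never change. As doubling is
    monotone in [h] and the same [B] is used for all indices, pointwise
    comparable functions give nested sets. *)
Theorem purification (I J : finType) (h : I -> T -> R) (f : J -> T -> R) :
  nonatomic mu -> (forall i, fuzzy_set (h i)) ->
  (forall j, bounded_measurable (f j)) ->
  exists E : I -> set T, [/\ forall i, measurable (E i),
    forall i j, \int[mu]_(x in E i) f j x = \int[mu]_x (h i x * f j x) &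
    forall i k, (forall x, h i x <= h k x) -> E i `<=` E k].
Proof.
move=> mu_na fh hf.
pose fuzzy_family (g : I -> T -> R) := forall i, fuzzy_set (g i).
have step g : exists B, fuzzy_family g -> [/\ measurable B,
    forall i j, \int[mu]_x (doubling B (g i) x * f j x) =
                \int[mu]_x (g i x * f j x) &
    forall i, m (undecided (doubling B (g i))) <= m (undecided (g i)) / 2].
  have [fg|ng] := pselect (fuzzy_family g); last by exists set0 => /ng.
  by have [B HB] := doubling_step mu_na fg hf; exists B.
have [b bP] := choice step.
pose H n := iter n (fun g i => doubling (b g) (g i)) h.
have fH n : fuzzy_family (H n).
  elim: n => [//|n IH] i; have [mB _ _] := bP _ IH; exact: doubling_fuzzy.
have intH n i j : \int[mu]_x (H n i x * f j x) = \int[mu]_x (h i x * f j x).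
  by elim: n => [//|n <-]; have [_ + _] := bP _ (fH n); apply.
have undH n i : m (undecided (H n i)) <= m (undecided (h i)) / 2 ^+ n.
  elim: n => [|n IH]; first by rewrite expr0 divr1.
  have [_ _ /(_ i)/le_trans] := bP _ (fH n); apply.
  by rewrite exprSr invfM mulrA ler_pM2r.
have decided_stable n k i x :
    H n i x = 0 \/ H n i x = 1 -> H (n + k)%N i x = H n i x.
  move=> H01; elim: k => [|k IH]; first by rewrite addn0.
  by rewrite addnS /= doubling_crisp -/(H _) IH.
have leH n i k : (forall x, h i x <= h k x) -> forall x, H n i x <= H n k x.
  by move=> hik; elim: n => [//|n IH] x; exact: le_doubling.
pose E i := \bigcup_n [set x | H n i x = 1].
have mE i : measurable (E i).
  apply: bigcup_measurable => n _.
  rewrite (_ : [set x | _] = setT `&` H n i @^-1` [set 1]); last by rewrite setTI.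
  by have [mH _] := fH n i; apply: mH.
have EH n i x : ~ undecided (H n i) x -> \1_(E i) x = H n i x.
  move=> nU; have [_ /(_ x) H01] := fH n i.
  have [H0|H0] := leP (H n i x) 0.
    have {}H0 : H n i x = 0 by lra.
    rewrite H0 indicE memNset// => -[k _ /= Hk].
    have := @decided_stable n k i x (or_introl H0).
    have := @decided_stable k n i x (or_intror Hk).
    by rewrite addnC => ->; rewrite H0 Hk; lra.
  have H1 : H n i x = 1.
    by apply/eqP; rewrite eq_le; move: H01 nU; rewrite /undecided /= H0 /=; lra.
  by rewrite H1 indicE mem_set//; exists n.
exists E; split=> //.
- move=> i j; apply/eqP; rewrite -subr_eq0; apply/eqP.
  have [_ [C fC]] := hf j.
  have C0 : 0 <= C by exact: le_trans (fC point).
  apply: (@le_geometric_eq0 _ _ (C * m (undecided (h i)))) => n.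
  have mU : measurable (undecided (H n i)).
    by apply: measurable_between; case: (fH n i).
  have h1 : bounded_measurable (fun x => f j x * \1_(E i) x).
    by apply: bmeasM => //; exact: bmeas_indic.
  have h2 : bounded_measurable (fun x => H n i x * f j x).
    by apply: bmeasM => //; apply: fuzzy_bmeas; exact: fH.
  rewrite -(intH n) Rintegral_indic -RintegralB//; try exact: bmeas_integrable.
  rewrite (_ : \int[mu]_x _ = \int[mu]_(x in undecided (H n i))
      (f j x * \1_(E i) x - H n i x * f j x)); last first.
    rewrite [RHS]Rintegral_mkcond; apply: eq_Rintegral => x _.
    rewrite patchE; case: ifPn => // /negP xU.
    rewrite (EH n); first by rewrite mulrC subrr.
    by move=> Ux; apply: xU; rewrite inE.
  rewrite -mulrA; apply: (@le_trans _ _ (C * m (undecided (H n i)))); last first.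
    by apply: ler_wpM2l.
  apply: bmeas_le_Rintegral => //; first exact: bmeasB.
  move=> x; rewrite [H n i x * _]mulrC -mulrBr normrM.
  rewrite -[leRHS]mulr1; apply: ler_pM => //.
  have [_ /(_ x) H01] := fH n i.
  by rewrite indicE; case: (_ \in _); rewrite ?mulr1n ?mulr0n ler_norml; lra.
- move=> i k hik x [n _ /= H1]; exists n => //=.
  have := leH n _ _ hik x; have [_ /(_ x)] := fH n k; lra.
Qed.

End Purification.

(** * Densities of measures below a finite measure *)

Section Densities.
Context d (T : measurableType d) (R : realType).
Variable mu : {finite_measure set T -> \bar R}.
Implicit Types (A B : set T) (nu : {measure set T -> \bar R}).

(** Domination by [mu] makes [nu] finite and absolutely continuous. The version
    of the Radon-Nikodym derivative that is finite and nonnegative everywhere is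
    used, so that sums of such densities are real-valued and increase
    pointwise. *)
Lemma dominated_density nu :
  (forall A, measurable A -> (nu A <= mu A)%E) ->
  exists g : T -> R, [/\ measurable_fun [set: T] g, forall x, 0 <= g x,
    forall A, measurable A -> nu A = (\int[mu]_(x in A) (g x)%:E)%E &
    forall f, bounded_measurable f ->
      (\int[nu]_x (f x)%:E = \int[mu]_x (f x * g x)%:E)%E].
Proof.
move=> nu_mu.
have nuoo : (nu setT < +oo)%E.
  apply: (le_lt_trans (nu_mu _ measurableT)).
  by rewrite -ge0_fin_numE// fin_num_measure.
pose la : {finite_measure set T -> \bar R} := mfrestr measurableT nuoo.
have laE A : la A = nu A by rewrite /la /= /mfrestr /mrestr setIT.
have dom : la `<< mu.
  apply/null_content_dominatesP => A mA A0; apply: etrans (laE A) _.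
  by apply/eqP; rewrite -measure_le0 -A0; exact: nu_mu.
pose g0 := Radon_Nikodym_SigmaFinite.f la mu.
have g0E x : (fine (g0 x))%:E = g0 x.
  by rewrite fineK// Radon_Nikodym_SigmaFinite.f_fin_num.
have mg0 : measurable_fun [set: T] g0.
  exact: measurable_int (Radon_Nikodym_SigmaFinite.f_integrable dom).
exists (fun x => fine (g0 x)); split.
- exact: measurableT_comp.
- by move=> x; rewrite fine_ge0// Radon_Nikodym_SigmaFinite.f_ge0.
- move=> A mA; rewrite -laE (Radon_Nikodym_SigmaFinite.f_integral dom mA).
  by apply: eq_integral => x _; rewrite g0E.
- move=> f hf; have [mf _] := hf.
  have mEf : measurable_fun [set: T] (EFin \o f) by exact/measurable_EFinP.
  transitivity (\int[la]_x (f x)%:E)%E.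
    by apply: eq_measure_integral => A _ _; exact: esym (laE A).
  rewrite -(Radon_Nikodym_change_of_variables dom)//; last first.
    exact: (bmeas_integrable la).
  apply: ae_eq_integral => //.
  + by apply: emeasurable_funM => //; exact: measurable_int.
  + apply/measurable_EFinP/measurable_funM => //; exact: measurableT_comp.
  + rewrite [X in ae_eq _ _ _ X](_ : _ = (EFin \o f) \* g0)%E; last first.
      by apply/funext => x; rewrite EFinM g0E.
    exact/ae_eqe_mul2l/ae_eq_sym/ae_eq_Radon_Nikodym_SigmaFinite.
Qed.

(** The indicator of [A] is a density of the restricted measure, hence agrees
    almost everywhere with the one given by [dominated_density]. *)
Lemma integral_mrestr A (mA : measurable A) (f : T -> R) : bounded_measurable f ->
  (\int[mrestr mu mA]_x (f x)%:E = \int[mu]_(x in A) (f x)%:E)%E.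
Proof.
move=> hf; have [mf _] := hf.
have [B mB|g [mg g0 gE ->//]] := @dominated_density (mrestr mu mA).
  by rewrite /mrestr; apply: le_measure; rewrite ?inE//; exact: measurableI.
have mEg : measurable_fun [set: T] (EFin \o g) by exact/measurable_EFinP.
have mE1 : measurable_fun [set: T] (EFin \o (\1_A : T -> R)).
  by apply/measurable_EFinP; exact: measurable_indic.
have gA : ae_eq mu setT (EFin \o (\1_A : T -> R)) (EFin \o g).
  apply: integral_ae_eq => //.
    exact: (bmeas_integrable mu measurableT (bmeas_indic _ mA)).
  move=> B _ mB; rewrite -gE// /mrestr /=.
  by rewrite integral_indic// setIC.
transitivity (\int[mu]_x (f x * \1_A x)%:E)%E.
  apply: ae_eq_integral => //.
  - exact/measurable_EFinP/measurable_funM.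
  - by apply/measurable_EFinP/measurable_funM => //; exact: measurable_indic.
  - have := ae_eqe_mul2l (EFin \o f) gA; exact: ae_eq_sym.
rewrite [RHS]integral_mkcond; apply: eq_integral => x _.
by rewrite patchE indicE; case: (x \in A); rewrite /= ?mulr1 ?mulr0.
Qed.

(** The densities of the [nu i] are encoded by their partial sums truncated at
    1, which form an increasing chain of fuzzy sets: this is the form in which
    [purification] yields disjoint sets, as differences of nested ones. The
    truncation is invisible to integrals because the densities sum to at most 1
    almost everywhere: on the set where the sum exceeds 1, its integral is at
    most the measure of that set. *)
Lemma cumulative_density N (nu : 'I_N -> {measure set T -> \bar R}) :
  (forall A, measurable A -> (\sum_(i < N) nu i A <= mu A)%E) ->
  exists G : nat -> T -> R, [/\ forall k, fuzzy_set (G k),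
    forall k l x, (k <= l)%N -> G k x <= G l x &
    forall (i : 'I_N) f, bounded_measurable f ->
      (\int[nu i]_x (f x)%:E)%E =
      (\int[mu]_x ((G i.+1 x - G i x) * f x))%:E].
Proof.
move=> nu_mu.
have nu_le i A : measurable A -> (nu i A <= mu A)%E.
  move=> mA; apply: le_trans (nu_mu A mA).
  by rewrite (bigD1 i)//= leeDl// sume_ge0.
have [g gP] := choice (fun i => dominated_density (nu_le i)).
have mg i : measurable_fun [set: T] (g i) by case: (gP i).
have g0 i x : 0 <= g i x by case: (gP i).
pose S k x := \sum_(i < N | (i < k)%N) g i x.
have mS k : measurable_fun [set: T] (S k).
  pose s := [seq i : 'I_N <- index_enum 'I_N | (i < k)%N].
  rewrite (_ : S k = fun x => \sum_(i <- s) g i x); first exact: measurable_sum.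
  by apply/funext => x; rewrite /S big_filter.
have S0 k x : 0 <= S k x by exact: sumr_ge0.
have leS k l x : (k <= l)%N -> S k x <= S l x.
  move=> kl; rewrite /S [leRHS](bigID (fun i : 'I_N => (i < k)%N)) /=.
  rewrite [X in _ <= X + _](eq_bigl (fun i : 'I_N => (i < k)%N)).
    by rewrite lerDl sumr_ge0.
  by move=> i /=; case: (ltnP i k) => [/leq_trans->//|]; rewrite ?andbF.
have SN x : S N x = \sum_(i < N) g i x by apply: eq_bigl => i; rewrite ltn_ord.
have Si (i : 'I_N) x : S i.+1 x = S i x + g i x.
  rewrite /S (bigD1 i)//= addrC; congr (_ + _); apply: eq_bigl => j.
  by rewrite ltnS andbC [RHS]ltn_neqAle.
pose E := [set x | 1 < S N x].
have mE : measurable E.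
  rewrite (_ : E = setT `&` S N @^-1` `]1, +oo[%classic); first exact: mS.
  by rewrite setTI; apply/seteqP; split=> x /=; rewrite in_itv/= andbT.
have E0 : mu E = 0%E.
  have intS : (\int[mu]_(x in E) (S N x)%:E = \sum_(i < N) nu i E)%E.
    under eq_integral do rewrite SN -sumEFin.
    rewrite ge0_integral_sum//.
    - by apply: eq_bigr => i _; have [_ _ ->] := gP i.
    - by move=> i; apply/measurable_EFinP; exact: measurable_funTS.
    - by move=> i x _; rewrite lee_fin.
  have mS1 : measurable_fun E (fun x => (S N x - 1)%:E).
    by apply/measurable_EFinP/measurable_funTS/measurable_funB.
  have splitS : (\int[mu]_(x in E) (S N x)%:E =
      \int[mu]_(x in E) (S N x - 1)%:E + mu E)%E.
    rewrite -[X in _ = (_ + X)%E]mul1e -integral_cst// -ge0_integralD//.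
    - by apply: eq_integral => x _; rewrite /= -EFinD subrK.
    - by move=> x /= Ex; rewrite lee_fin subr_ge0 ltW.
  have int0 : (\int[mu]_(x in E) `|(S N x - 1)%:E| = 0)%E.
    rewrite (eq_integral (fun x => (S N x - 1)%:E)); last first.
      by move=> x; rewrite inE => Ex; rewrite gee0_abs// lee_fin subr_ge0 ltW.
    apply/eqP; rewrite eq_le integral_ge0 ?andbT; last first.
      by move=> x Ex; rewrite lee_fin subr_ge0 ltW.
    have := nu_mu _ mE; rewrite -intS splitS.
    by rewrite -[leRHS]add0e leeD2rE// fin_num_measure.
  have /(ae_eq_integral_abs mu mE mS1) := int0.
  move=> [Z [mZ Z0 EZ]]; apply: (subset_measure0 mE mZ _ Z0).
  apply: subset_trans EZ => x Ex /= /(_ Ex); move: Ex; rewrite /E /=.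
  by move=> Ex [] S1; move: Ex; lra.
pose G k x := Num.min 1 (S k x).
have fG k : fuzzy_set (G k).
  split; first exact: measurable_minr.
  by move=> x; rewrite /G; have := S0 k x; case: (ltP 1 (S k x)); lra.
exists G; split => //.
- move=> k l x /(leS _ _ x); rewrite /G.
  by case: (ltP 1 (S k x)); case: (ltP 1 (S l x)); lra.
- move=> i f hf; have [mf _] := hf; have [_ _ _ ->//] := gP i.
  have hG : bounded_measurable (fun x => (G i.+1 x - G i x) * f x).
    by apply: bmeasM => //; apply: bmeasB; exact: fuzzy_bmeas.
  rewrite fineK; last first.
    exact/integrable_fin_num/(bmeas_integrable mu measurableT hG).
  apply: ae_eq_integral => //.
  + exact/measurable_EFinP/measurable_funM.
  + by case: hG => mG _; exact/measurable_EFinP.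
  + exists E; split=> // x /= nx; apply: contrapT => nE; apply: nx => _.
    have SN1 : S N x <= 1 by move: nE; rewrite /E /=; case: (ltP 1 (S N x)).
    have GS k : (k <= N)%N -> G k x = S k x.
      by move=> /(leS _ _ x) SkN; apply/min_idPr; exact: le_trans SN1.
    by rewrite !GS ?(ltnW (ltn_ord i))// Si addrAC subrr add0r mulrC.
Qed.

End Densities.

(** * From weak to strong partitions *)

Section WeakToStrong.
Context d (T : measurableType d) (R : realType).
Variable mu : {finite_measure set T -> \bar R}.
Implicit Types (A B : set T).

Local Notation m A := (fine (mu A)).

(** Quantifying over [A] makes the induction work: the overlap of one more set
    with the previous union is an instance of the induction hypothesis. *)
Lemma sum_measureI_ae_disjoint (I : finType) (P : I -> set T) A :
  (forall i, measurable (P i)) -> measurable A ->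
  (forall i j, i != j -> mu (P i `&` P j) = 0%E) ->
  \sum_i m (A `&` P i) = m (A `&` \bigcup_i P i).
Proof.
move=> mP mA P0; have ml := lip_additive_measure mu.
have -> : \bigcup_i P i = \big[setU/set0]_(i <- index_enum I) P i.
  rewrite -bigcup_seq; apply: eq_bigcupl; split=> i //= _.
  exact: mem_index_enum.
elim: (index_enum I) (index_enum_uniq I) A mA
  => [_ A mA|k s IH /= /andP[ks us] A mA].
  by rewrite !big_nil setI0 measure0.
rewrite !big_cons IH//; set U := \big[setU/set0]_(i <- s) P i.
have mU : measurable U by exact: bigsetU_measurable.
have null : m (A `&` P k `&` U) = 0.
  rewrite -IH//; last exact: measurableI.
  rewrite big_seq big1// => j js; rewrite -setIA.
  suff -> : mu (A `&` (P k `&` P j)) = 0%E by [].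
  have mkj : measurable (P k `&` P j) by exact: measurableI.
  apply: (subset_measure0 _ mkj (@subIsetr _ _ _)); first exact: measurableI.
  by apply: P0; apply: contraNneq ks => ->.
have mAk : measurable (A `&` P k) by exact: measurableI.
have mAU : measurable (A `&` U) by exact: measurableI.
rewrite setIUr.
have -> : (A `&` P k) `|` (A `&` U) = ((A `&` P k) `\` U) `|` (A `&` U).
  apply/seteqP; split=> x [[Ax hx]|[Ax Ux]].
  - by have [Ux|nU] := pselect (U x); [right|left].
  - by right.
  - by case: Ax hx => ? ? _; left.
  - by right.
rewrite (lip_additiveU ml)//; last 2 first.
- exact: measurableD.
- by apply/seteqP; split => // x [[_ nU] [_]].
by congr (_ + _); rewrite (lip_additive_split ml mAk mU) null add0r.
Qed.

(** The points missed by the [P i] form a null set, which is given to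
    [P i0]. *)
Lemma partition_of_disjoint (I : finType) (i0 : I) (P : I -> set T) :
  (forall i, measurable (P i)) -> (forall i j, i != j -> P i `&` P j = set0) ->
  \sum_i m (P i) = m setT ->
  exists Q : I -> set T, [/\ forall i, measurable (Q i), \bigcup_i Q i = setT,
    forall i j, i != j -> mu (Q i `&` Q j) = 0%E &
    forall nu, lip_additive mu nu -> forall i, nu (Q i) = nu (P i)].
Proof.
move=> mP P0 mPT; set U := \bigcup_i P i.
have mU : measurable U by exact: fin_bigcup_measurable.
have mZ : measurable (~` U) by exact: measurableC.
have Z0 : m (~` U) = 0.
  have P0' i j : i != j -> mu (P i `&` P j) = 0%E.
    by move=> /P0 ->; rewrite measure0.
  have := sum_measureI_ae_disjoint mP measurableT P0'.
  under eq_bigr do rewrite setTI.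
  rewrite setTI mPT => mTU.
  rewrite -setTD (lip_additiveD (lip_additive_measure mu))//.
  by rewrite mTU subrr.
have muZ0 : mu (~` U) = 0%E by rewrite -(EFin_fine_measure mu mZ) Z0.
pose Q i := if i == i0 then P i `|` ~` U else P i.
have QPZ i : Q i `<=` P i `|` ~` U.
  by rewrite /Q; case: eqP => _ x Px //; left.
have PQ i : P i `<=` Q i by rewrite /Q; case: eqP => _ x Px //; left.
have mQ i : measurable (Q i) by rewrite /Q; case: eqP => _ //; exact: measurableU.
exists Q; split=> //.
- apply/seteqP; split=> // x _; have [[i _ Pix]|nU] := pselect (U x).
    by exists i => //; exact: PQ.
  by exists i0 => //; rewrite /Q eqxx; right.
- move=> i j ij; apply: (subset_measure0 _ mZ _ muZ0).
    exact: measurableI.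
  move=> x [/QPZ[Pix|//] /QPZ[Pjx|//]].
  by have : (P i `&` P j) x by []; rewrite P0.
- move=> nu nul i; rewrite /Q; case: eqP => // _.
  rewrite (lip_additiveU nul)//; last first.
    by apply/seteqP; split=> // x [Px]; apply; exists i.
  have [_ [C _ /(_ _ mZ)]] := nul.
  by rewrite Z0 mulr0 normr_le0 => /eqP ->; rewrite addr0.
Qed.

Lemma bmeas_EFin_Rintegral A (f : T -> R) : measurable A -> bounded_measurable f ->
  (\int[mu]_(x in A) (f x)%:E = (\int[mu]_(x in A) f x)%:E)%E.
Proof.
move=> mA hf; rewrite fineK//.
exact: integrable_fin_num (bmeas_integrable mu mA hf).
Qed.

(** Purification of the chain of cumulative densities gives nested sets, and the
    integral over the difference of two consecutive ones is the integral against
    the corresponding [nu i]. *)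
Theorem disjoint_of_weak N (nu : 'I_N -> {measure set T -> \bar R})
    (f : 'I_N -> T -> R) :
  nonatomic mu -> (forall i, bounded_measurable (f i)) ->
  (forall A, measurable A -> (\sum_(i < N) nu i A <= mu A)%E) ->
  exists P : 'I_N -> set T, [/\ forall i, measurable (P i),
    forall i j, i != j -> P i `&` P j = set0,
    forall i, nu i setT = mu (P i) &
    forall i, (\int[mu]_(x in P i) (f i x)%:E = \int[nu i]_x (f i x)%:E)%E].
Proof.
move=> mu_na hf nu_mu.
have [G [fG leG nuG]] := cumulative_density nu_mu.
(* the constant test function 1 keeps track of the total masses *)
pose tst (o : option 'I_N) x : R := if o is Some i then f i x else 1.
have htst o : bounded_measurable (tst o).
  by case: o => [i|]; [exact: hf|exact: bmeas_cst].
have [E [mE intE leE]] :=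
  purification (h := fun k : 'I_N.+1 => G k) mu_na (fun k => fG k) htst.
pose lo (i : 'I_N) : 'I_N.+1 := widen_ord (leqnSn N) i.
pose up (i : 'I_N) : 'I_N.+1 := lift ord0 i.
have E_le (k l : 'I_N.+1) : (k <= l)%N -> E k `<=` E l.
  by move=> kl; apply: leE => x; exact: leG.
pose P i := E (up i) `\` E (lo i).
have mP i : measurable (P i) by exact: measurableD.
have intP i o : (\int[mu]_(x in P i) (tst o x)%:E = \int[nu i]_x (tst o x)%:E)%E.
  have h1 k : bounded_measurable (fun x => G k x * tst o x).
    by apply: bmeasM => //; exact: fuzzy_bmeas.
  rewrite bmeas_EFin_Rintegral// nuG//; congr (_%:E).
  have := lip_additiveD (lip_additive_Rintegral mu (htst o))
    (mE (up i)) (mE (lo i)).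
  rewrite /P => ->; last by apply: E_le; rewrite /= /bump.
  rewrite !intE -RintegralB//; try exact: bmeas_integrable.
  by apply: eq_Rintegral => x _; rewrite mulrBl.
exists P; split=> //.
- move=> i j; wlog ij : i j / (i < j)%N.
    move=> hw; rewrite neq_ltn => /orP[ij|ji].
      by apply: hw => //; rewrite neq_ltn ij.
    by rewrite setIC; apply: hw => //; rewrite neq_ltn ji.
  move=> _; apply/seteqP; split=> // x [[Ei _] [_]]; apply.
  by move: Ei; apply: E_le.
- move=> i; have := intP i None; rewrite /tst.
  by rewrite !integral_cst// !mul1e.
- by move=> i; exact: (intP i (Some i)).
Qed.

Theorem partition_of_weak N (nu : 'I_N -> {measure set T -> \bar R})
    (f : 'I_N -> T -> R) :
  nonatomic mu -> (0 < mu setT)%E -> (forall i, bounded_measurable (f i)) ->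
  (forall A, measurable A -> (\sum_(i < N) nu i A = mu A)%E) ->
  exists Q : 'I_N -> set T, [/\ forall i, measurable (Q i),
    \bigcup_i Q i = setT,
    forall i j, i != j -> mu (Q i `&` Q j) = 0%E &
    forall i, (\int[mu]_(x in Q i) (f i x)%:E = \int[nu i]_x (f i x)%:E)%E].
Proof.
move=> mu_na mu0 hf nu_mu.
have nu_le A : measurable A -> (\sum_(i < N) nu i A <= mu A)%E.
  by move=> mA; rewrite nu_mu.
have [P [mP P0 nuP intP]] := disjoint_of_weak mu_na hf nu_le.
(* without any index the empty sum would be [mu setT], which is positive *)
have [i0 _] : exists i0 : 'I_N, True.
  apply: contrapT => noI; move: mu0; rewrite -nu_mu// big1 ?ltxx// => i _.
  by exfalso; apply: noI; exists i.
have mPT : \sum_i m (P i) = m setT.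
  rewrite -nu_mu// -sum_fine; first by apply: eq_bigr => i _; rewrite nuP.
  by move=> i _; rewrite nuP fin_num_measure.
have [Q [mQ QT Q0 QP]] := partition_of_disjoint i0 mP P0 mPT.
exists Q; split=> // i; rewrite -intP !bmeas_EFin_Rintegral//; congr (_%:E).
exact: QP (lip_additive_Rintegral mu (hf i)) i.
Qed.

Lemma sum_mrestr (I : finType) (P : I -> set T)
    (mP : forall i, measurable (P i)) A :
  (forall i j, i != j -> mu (P i `&` P j) = 0%E) -> measurable A ->
  (\sum_i mrestr mu (mP i) A = mu (A `&` \bigcup_i P i))%E.
Proof.
move=> P0 mA.
have mU : measurable (A `&` \bigcup_i P i).
  by apply: measurableI => //; exact: fin_bigcup_measurable.
rewrite -(EFin_fine_measure mu mU) -sum_measureI_ae_disjoint// -sumEFin.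
by apply: eq_bigr => i _; rewrite EFin_fine_measure//; exact: measurableI.
Qed.

End WeakToStrong.

(** * Continuous functions on a compact space *)

Section Borel.
Context (R : realType) (X : ptopologicalType).

Lemma continuous_bmeas (f : X -> R) : compact [set: X] -> continuous f ->
  bounded_measurable (f : borelType X -> R).
Proof.
move=> cX cf; split.
  apply: (measurability _ (RGenOInfty.measurableE R)) => _ [_ [a ->] <-].
  rewrite setTI; apply: sub_sigma_algebra.
  by apply: open_comp; [move=> x _; exact: cf|exact: interval_open].
have /compact_bounded[C [_ fC]] : compact (f @` [set: X]).
  by apply: continuous_compact => //; exact: continuous_subspaceT.
exists (C + 1) => x; apply: (fC (C + 1)); first by rewrite ltrDl.
by exists x.
Qed.

End Borel.

(** * Realized vectors *)

Theorem theorem2p1 (R : realType) (X : ptopologicalType) (N : nat)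
    (mu : probability (borelType X) R) (psi : 'I_N -> X -> R)
    (X_compact : compact [set: X]) (X_polish : polish_space R X)
    (mu_nonatomic : nonatomic mu)
    (psi_continuous : forall i : 'I_N, continuous (psi i)) :
  S_strong mu psi = S_weak mu psi /\
  S_strong_sub mu psi = S_weak_sub mu psi.
Proof.
have hpsi i : bounded_measurable (psi i : borelType X -> R).
  exact: continuous_bmeas.
have weak_of_strong (P : 'I_N -> set (borelType X))
    (mP : forall i, measurable (P i)) i :
    (\int[mrestr mu (mP i)]_x (psi i x)%:E = \int[mu]_(x in P i) (psi i x)%:E)%E.
  exact: integral_mrestr.
split; apply/seteqP; split=> v.
- move=> [P [mP PT P0 Pv]]; exists (fun i => mrestr mu (mP i)); split.
    by move=> A mA; have := sum_mrestr mP P0 mA; rewrite PT setIT.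
  by move=> i; rewrite weak_of_strong Pv.
- move=> [nu [nu_mu nuv]].
  have mu0 : (0 < mu setT)%E by rewrite probability_setT.
  have [Q [mQ QT Q0 intQ]] := partition_of_weak mu_nonatomic mu0 hpsi nu_mu.
  by exists Q; split=> // i; rewrite -nuv -intQ.
- move=> [P [mP PT P0 Pv]]; exists (fun i => mrestr mu (mP i)); split.
    move=> A mA; have := sum_mrestr mP P0 mA => /= ->.
    apply: le_measure; rewrite ?inE//; apply: measurableI => //.
    exact: fin_bigcup_measurable.
  by move=> i; rewrite weak_of_strong Pv.
- move=> [nu [nu_mu nuv]].
  have [P [mP P0 _ intP]] := disjoint_of_weak mu_nonatomic hpsi nu_mu.
  exists P; split=> // [i j ij|i]; last by rewrite -nuv -intP.
  by rewrite P0// measure0.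
Qed.
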